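(* Let $d\in\mathbb{N}$ and $\eta>1/d$. Then \[\dim_H(\mathcal{D}(\eta))=\frac{d+1}{1+\eta}.\]
   Context: For $\boldsymbol{\alpha}\in\mathbb{R}^d$ and $\eta\in\mathbb{R}$, let $\mathrm{NA}_\eta(\boldsymbol{\alpha})=\{|q|^{\eta}(q\boldsymbol{\alpha}-\boldsymbol{p}):q\in\mathbb{Z}\setminus\{0\},\ \boldsymbol{p}\in\mathbb{Z}^d\}$ and let $\mathcal{A}_\eta(\boldsymbol{\alpha})$ be the set of accumulation points of $\mathrm{NA}_\eta(\boldsymbol{\alpha})$. Define $\mathcal{D}(\eta)=\{\boldsymbol{\alpha}\in\mathbb{R}^d:\mathcal{A}_\eta(\boldsymbol{\alpha})=\mathbb{R}^d\}$. $\dim_H$ denotes Hausdorff dimension. *)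

(* Defs.v *)
From HB Require Import structures.
From mathcomp Require Import all_boot all_order all_algebra.
From mathcomp Require Import all_classical all_reals all_analysis.
Set Implicit Arguments. Unset Strict Implicit. Unset Printing Implicit Defensive.
Import Order.TTheory GRing.Theory Num.Theory.
Import numFieldNormedType.Exports.
Local Open Scope classical_set_scope.
Local Open Scope ring_scope.

Section Defs.
Variables (R : realType) (d : nat).
Local Notation V := 'rV[R]_d.

Definition edist (x y : V) : R := Num.sqrt (\sum_(i < d) (x ord0 i - y ord0 i) ^+ 2).

(* diameter (Euclidean), with diam of the empty set = 0 *)
Definition ediam (U : set V) : \bar R :=
  ereal_sup ([set 0%E] `|` [set (edist x y)%:E | x in U & y in U]).

Definition hterm (s : R) (U : set V) : \bar R :=
  if `[< U = set0 >] then 0%E else (ediam U `^ s)%E.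

Definition hausdorff_delta (s delta : R) (A : set V) : \bar R :=
  ereal_inf [set (\sum_(i <oo) hterm s (U i))%E | U in
    [set U : nat -> set V | A `<=` \bigcup_i U i /\ forall i, (ediam (U i) <= delta%:E)%E]].

Definition hausdorff_measure (s : R) (A : set V) : \bar R :=
  ereal_sup [set hausdorff_delta s delta A | delta in [set delta : R | 0 < delta]].

Definition hausdorff_dim (A : set V) : \bar R :=
  ereal_inf [set s%:E | s in [set s : R | 0 <= s /\ hausdorff_measure s A = 0%E]].

Definition NA (eta : R) (alpha : V) : set V :=
  [set v | exists (q : int) (p : 'rV[int]_d), q != 0 /\
     v = (`|q%:~R| `^ eta : R) *: (q%:~R *: alpha - map_mx (fun z : int => z%:~R) p)].

Definition Acc (eta : R) (alpha : V) : set V := limit_point (NA eta alpha).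

Definition Dset (eta : R) : set V := [set alpha | Acc eta alpha = setT].

End Defs.

(* Main.v *)
(* Upper bound: a point alpha of D(eta) satisfies |alpha - p/q| <= q^(-1-eta) for
   infinitely many q. Grouping the denominators in dyadic blocks [2^t, 2^(t+1)),
   the balls around the p/q give covers whose s-sums are tails of a geometric
   series as soon as (1 + eta) s > d + 1.

   Lower bound: alpha lies in D(eta) iff NA_eta(alpha) is dense, so D(eta) is a
   countable intersection of open sets. Given balls B(c_i, w_i) with
   sum_i w_i^s small, a point of D(eta) outside all of them is the limit of nested
   boxes, each "light": the balls meeting a box of radius ell have total mass
   sum w_i^s <= eps ell^s. To pass from a box to a light sub-box all of whose points
   have an element of NA_eta near a prescribed target v, take a grid of mesh
   h = k / N^(d+1) in the box. On average over the grid, few balls larger than h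
   come near a grid point, the mass of the smaller ones near it is small because
   (1 + eta) s < d + 1, and few grid points are close to a rational point of
   denominator at most N^d / k. So some grid point y avoids all three; Dirichlet's
   theorem gives p/q close to y with N^d / k < q <= N^d, and the sub-box of radius
   rho = tau N^(-d(1+eta)) is centred at (p + q^(-eta) v) / q. *)
Require Import Defs.
From HB Require Import structures.
From mathcomp Require Import all_boot all_order all_algebra.
From mathcomp Require Import all_classical all_reals all_analysis.
From mathcomp Require Import ring lra zify.
Import Order.TTheory GRing.Theory Num.Theory.
Import numFieldNormedType.Exports.
Local Open Scope ring_scope.
Local Open Scope classical_set_scope.

(** * Counting and Dirichlet's theorem *)

Section Counting.
Context {R : realType}.
Implicit Types (u theta z r : R).

(** The selected indices all exceed the least one by at most [2 * r / theta]. *)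
Lemma card_progression_interval m u theta z r : 0 < theta -> 0 <= r ->
  #|[pred a : 'I_m | `|u + theta * a%:R - z| <= r]|%:R <= 2 * r / theta + 1.
Proof.
move=> theta0 r0; set A := [pred a : 'I_m | _].
have rt0 : 0 <= 2 * r / theta by rewrite divr_ge0 ?mulr_ge0 // ltW.
have [a0 Aa0|A0] := pickP A; last first.
  by rewrite (eq_card0 A0) addr_ge0.
case: (arg_minnP (val : 'I_m -> nat) Aa0) => b Ab bmin.
pose K := Num.truncn (2 * r / theta).
have inK a : A a -> (a - b < K.+1)%N.
  move=> Aa; rewrite ltnS truncn_ge_nat // ler_pdivlMr //.
  rewrite natrB ?bmin //.
  move: Aa Ab; rewrite !inE !ler_norml => /andP[_ h1] /andP[h2 _].
  by lra.
have inj : {in A &, injective (fun a : 'I_m => inord (a - b) : 'I_K.+1)}.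
  move=> a c Aa Ac /(congr1 (val : 'I_K.+1 -> nat)) /=.
  rewrite !inordK ?inK // => e; apply/val_inj => /=.
  by rewrite -(subnK (bmin _ Aa)) e subnK // bmin.
have := leq_card_in _ _ inj; rewrite card_ord -(ler_nat R) => h.
apply: le_trans h _; rewrite -natr1 lerD2r.
by rewrite -truncn_ge_nat.
Qed.

(** At most [theta * m + 3] integers come within reach of the progression, and each captures only
    the terms in an interval of radius [r] around it. *)
Lemma card_progression_near_int m u theta r : 0 < theta -> 0 <= r -> 2 * r <= 1 ->
  #|[pred a : 'I_m | `[< exists p : int, `|u + theta * a%:R - p%:~R| <= r >]]|%:R
    <= (theta * m%:R + 3) * (2 * r / theta + 1).
Proof.
move=> theta0 r0 r1; set A := [pred a : 'I_m | _].
pose p0 := Num.floor (u - r); pose K := (Num.truncn (theta * m%:R + 2 * r + 1)).+1.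
have tm0 : 0 <= theta * m%:R by rewrite mulr_ge0 // ltW.
have K0 : 0 <= theta * m%:R + 2 * r + 1 by lra.
have [p0l p0u] : p0%:~R <= u - r /\ u - r < p0%:~R + 1.
  by have := floor_itv (u - r); rewrite intrD => /andP[].
pose B (i : 'I_K) := [pred a : 'I_m | `|u + theta * a%:R - (p0 + i%:Z)%:~R| <= r].
have /subset_leq_card cover : A \subset [pred a | [exists i, B i a]].
  apply/fintype.subsetP => a /asboolP[p hp]; rewrite inE.
  move: (hp); rewrite ler_norml => /andP[h1 h2].
  have ta : theta * a%:R <= theta * m%:R by rewrite ler_pM2l // ler_nat ltnW.
  have ta0 : 0 <= theta * a%:R by rewrite mulr_ge0 // ltW.
  have pp0 : p0 <= p.
    have : p0%:~R < p%:~R + 1 :> R by lra.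
    by rewrite -[1]/(1%:~R) -intrD ltr_int ltzD1.
  have absE : (p - p0 = `|p - p0|%N%:Z)%R by rewrite gez0_abs // subr_ge0.
  have ltK : (`|p - p0|%N < K)%N.
    rewrite ltnS truncn_ge_nat //.
    have -> : `|p - p0|%N%:R = p%:~R - p0%:~R :> R.
      by rewrite -intrB absE.
    lra.
  apply/existsP; exists (Ordinal ltK); rewrite inE /= -absE.
  by rewrite [p0 + _]addrC subrK.
have le1 : (#|A| <= \sum_(i < K) #|B i|)%N.
  apply: leq_trans cover _.
  rewrite -sum1_card (eq_bigr (fun i => \sum_a (a \in B i : nat)%N)); last first.
    by move=> i _; rewrite -sum1_card big_mkcond.
  rewrite exchange_big /= big_mkcond /=; apply: leq_sum => a _.
  case: ifP => //; rewrite inE => /existsP[i Bi].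
  by rewrite (bigD1 i) //= inE Bi.
rewrite -(ler_nat R) natr_sum in le1.
apply: le_trans le1 _.
apply: le_trans (_ : \sum_(i < K) (2 * r / theta + 1) <= _).
  by apply: ler_sum => i _; exact: card_progression_interval.
rewrite sumr_const card_ord -[X in X <= _]mulr_natl.
apply: ler_wpM2r; first by rewrite addr_ge0 ?divr_ge0 ?mulr_ge0 // ltW.
rewrite /K -natr1.
have : (Num.truncn (theta * m%:R + 2 * r + 1))%:R <= theta * m%:R + 2 * r + 1.
  by rewrite truncn_le.
lra.
Qed.

Lemma card_ffun_pred (d m : nat) (P : 'I_d -> pred 'I_m) (C : R) :
  (forall j, #|P j|%:R <= C) ->
  #|[pred g : {ffun 'I_d -> 'I_m} | [forall j, P j (g j)]]|%:R <= C ^+ d.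
Proof.
move=> PC.
have -> : #|[pred g : {ffun 'I_d -> 'I_m} | [forall j, P j (g j)]]| =
    (\prod_(j < d) #|P j|)%N.
  rewrite -(big_map (fun j => #|P j|) xpredT id) -foldrE.
  rewrite /index_enum -enumT -card_family.
  apply: eq_card => g; apply/idP/idP.
    by rewrite inE => /forallP h; apply/forallP => j; exact: h.
  by move=> /familyP h; rewrite inE; apply/forallP => j; exact: h.
have -> : C ^+ d = \prod_(j < d) C by rewrite prodr_const card_ord.
rewrite natr_prod.
by apply: ler_prod => j _; rewrite ler0n PC.
Qed.

Lemma exists_lt1_of_sum (T : finType) (f : T -> R) :
  \sum_t f t < #|T|%:R -> exists t, f t < 1.
Proof.
move=> h; apply/existsP; apply: contraLR h; rewrite negb_exists => /forallP h.
rewrite -leNgt -sum1_card natr_sum; apply: ler_sum => t _.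
by rewrite leNgt h.
Qed.

(** Pigeonhole: the fractional parts of the [N ^ d + 1] multiples [q * y], with [q = 0] included,
    fall into [N ^ d] cubes of side 1/N; two multiples in the same cube are subtracted. *)
Lemma dirichlet d (y : 'I_d -> R) (N : nat) : (0 < N)%N ->
  exists (q : nat) (p : 'I_d -> int), [/\ (0 < q)%N, (q <= N ^ d)%N &
    forall j, `|q%:R * y j - (p j)%:~R| <= N%:R^-1].
Proof.
move=> N0; have N0R : 0 < N%:R :> R by rewrite ltr0n.
pose fl (q : nat) j := Num.floor (q%:R * y j).
pose fr (q : nat) j := q%:R * y j - (fl q j)%:~R.
have fr01 q j : 0 <= fr q j < 1.
  have := floor_itv (q%:R * y j); rewrite intrD => /andP[? ?].
  by rewrite /fr /fl; apply/andP; split; lra.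
have frN q j : (Num.truncn (N%:R * fr q j) < N)%N.
  have /andP[f0 f1] := fr01 q j.
  by rewrite truncn_lt_nat ?mulr_ge0 // -[X in _ < X]mulr1 ltr_pM2l.
pose F (q : 'I_(N ^ d).+1) : {ffun 'I_d -> 'I_N} := [ffun j => Ordinal (frN q j)].
have [q1 [q2 [lt12 e12]]] : exists q1 q2 : 'I_(N ^ d).+1, (q1 < q2)%N /\ F q1 = F q2.
  have : ~~ injectiveb F.
    apply/negP => /injectiveP /leq_card.
    by rewrite card_ffun !card_ord ltnn.
  move=> /injectivePn[q1 [q2 ne e]].
  have [lt|lt|/val_inj] := ltngtP q1 q2; first by exists q1, q2.
    by exists q2, q1.
  by move=> eq; rewrite eq eqxx in ne.
exists (q2 - q1)%N, (fun j => fl q2 j - fl q1 j); split.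
- by rewrite subn_gt0.
- by rewrite leq_subLR; have := ltn_ord q2; lia.
move=> j; have := congr1 (fun f : {ffun 'I_d -> 'I_N} => val (f j)) e12.
rewrite !ffunE /= => e.
have t0 q : 0 <= N%:R * fr q j by have /andP[f0 _] := fr01 q j; rewrite mulr_ge0.
have /andP[a1 a2] := truncn_itv (t0 q1).
have /andP[b1 b2] := truncn_itv (t0 q2).
rewrite e in a1 a2; rewrite -natr1 in a2 b2.
have -> : (q2 - q1)%N%:R * y j - (fl q2 j - fl q1 j)%:~R = fr q2 j - fr q1 j.
  by rewrite natrB ?(ltnW lt12) // intrB /fr; ring.
rewrite -[X in _ <= X]mul1r ler_pdivlMr // -[X in _ * X](ger0_norm (ltW N0R)) -normrM ler_norml.
by apply/andP; split; lra.
Qed.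

End Counting.

(** * Averaging over a grid *)

Section GoodPoint.
Context {R : realType} (d N k : nat) (s ell rho : R) (x : 'I_d -> R).
Variables (c : nat -> 'I_d -> R) (w : nat -> R).
Variables (eps h X : R) (m L : nat).
Let meets i := [forall j, `|x j - c i j| <= ell + w i].
Hypotheses (eps_def : eps = (4 * 36 ^+ d)^-1) (h_def : h = k%:R / N%:R ^+ d.+1).
Hypotheses (m_def : m = Num.truncn (ell / (2 * h))) (X_def : X = ell / (4 * h)).
Hypotheses (L_def : L = (Num.truncn (6 / ell)).+1).
Hypotheses (N_ge2 : (1 < N)%N) (k_def : k = (8 * 12 ^ d)%N).
Hypotheses (s_gt0 : 0 < s) (s_le : s <= d%:R) (ell_gt0 : 0 < ell) (ell_le1 : ell <= 1).
Hypotheses (rho_gt0 : 0 < rho) (w_gt0 : forall i, 0 < w i).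
Hypothesis h_le : 8 * h <= ell.
Hypothesis N_large : 8 * 6 ^+ d * L%:R * (7 / ell) ^+ d <= N%:R ^+ d.
Hypothesis rho_large : 9 ^+ d * (ell / rho) `^ s <= X ^+ d / 4.
Hypothesis mass : forall n,
  \sum_(i < n | meets i) w i `^ s <= eps * ell `^ s.

Let k_gt0 : (0 < k)%N. Proof. by rewrite k_def muln_gt0 expn_gt0. Qed.
Let N_gt0 : (0 : R) < N%:R. Proof. by rewrite ltr0n; lia. Qed.
Let h_gt0 : 0 < h. Proof. by rewrite h_def divr_gt0 ?exprn_gt0 ?N_gt0 ?ltr0n. Qed.
Let eps_gt0 : 0 < eps. Proof. by rewrite eps_def invr_gt0 mulr_gt0 ?exprn_gt0. Qed.
Let eps_le1 : eps <= 1.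
Proof.
rewrite eps_def invf_le1 ?mulr_gt0 ?exprn_gt0 // -[X in X <= _]mulr1 ler_pM //; first by lra.
by rewrite exprn_ege1 //; lra.
Qed.

Let m_le : h * m%:R <= ell / 2.
Proof.
have : m%:R <= ell / (2 * h) by rewrite m_def truncn_le divr_ge0 ?mulr_ge0 // ltW.
by rewrite ler_pdivlMr ?mulr_gt0 //; lra.
Qed.

Let X_gt0 : 0 < X. Proof. by rewrite X_def divr_gt0 ?mulr_gt0. Qed.

Let m_ge : X <= m%:R.
Proof.
have /truncn_itv/andP[_] : 0 <= ell / (2 * h) by rewrite divr_ge0 ?mulr_ge0 // ltW.
rewrite -m_def ltr_pdivrMr ?mulr_gt0 // => lt.
rewrite X_def ler_pdivrMr ?mulr_gt0 //; move: lt h_le ell_gt0; lra.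
Qed.

Let grid (g : {ffun 'I_d -> 'I_m}) j := x j + h * (g j)%:R.
(* A single ball of radius at least h already has weight 1, so total weight < 1
   at a grid point excludes all of these and bounds the mass of the others. *)
Let weight i := if h <= w i then 1 else w i `^ s / (eps * rho `^ s).
Let near_grid i g := [forall j, `|grid g j - c i j| <= 3 * h + w i].

Let weight_ge0 i : 0 <= weight i.
Proof.
by rewrite /weight; case: ifP => // _; rewrite divr_ge0 ?mulr_ge0 ?powR_ge0 // ltW.
Qed.

Let w_le i : meets i -> w i <= ell.
Proof.
move=> mi.
have : w i `^ s <= ell `^ s.
  apply: le_trans (_ : eps * ell `^ s <= _); last by rewrite ler_piMl ?powR_ge0.
  apply: le_trans (mass i.+1); rewrite (bigD1 ord_max) //= lerDl.
  by apply: sumr_ge0 => *; exact: powR_ge0.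
apply: contraTT; rewrite -!ltNge => lt; exact: gt0_ltr_powR (ltW ell_gt0) (ltW (w_gt0 i)) lt.
Qed.

(** Double counting: for each ball meeting the box, its weight times the number of grid points near
    it is at most a constant times w_i^s, and the mass of the box bounds the sum of these powers. *)
Lemma sum_weight_near_grid n :
  \sum_g \sum_(i < n | meets i && near_grid i g) weight i <= m%:R ^+ d / 2.
Proof.
(* The first summand of [A] serves the balls with [h <= w i], the second the smaller ones. *)
pose A := 9 ^+ d * (h ^- d * ell `^ (d%:R - s) + (eps * rho `^ s)^-1).
have count i : #|[pred g | near_grid i g]|%:R <= (2 * (3 * h + w i) / h + 1) ^+ d.
  pose P j := [pred a : 'I_m | `|x j + h * a%:R - c i j| <= 3 * h + w i].
  apply: (@card_ffun_pred _ _ _ P) => j.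
  apply: card_progression_interval => //.
  by rewrite addr_ge0 ?mulr_ge0 // ltW.
have bound i : meets i -> weight i * (2 * (3 * h + w i) / h + 1) ^+ d <= A * w i `^ s.
  move=> mi; have wi0 := w_gt0 i.
  have -> : 2 * (3 * h + w i) / h + 1 = 7 + 2 * (w i / h) by field; rewrite gt_eqF.
  have wh0 : 0 <= w i / h by rewrite divr_ge0 // ltW.
  rewrite /weight; case: ifP => [le|/negbT]; last rewrite -ltNge => lt.
    rewrite mul1r.
    apply: le_trans (_ : (9 * (w i / h)) ^+ d <= _).
      have : 1 <= w i / h by rewrite ler_pdivlMr // mul1r.
      by move: (w i / h) => t ?; apply: lerXn2r; rewrite ?nnegrE; lra.
    rewrite exprMn /A mulrDr mulrDl -[X in X <= _]addr0 lerD //; last first.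
      rewrite !mulr_ge0 ?powR_ge0 ?exprn_ge0 ?invr_ge0 ?mulr_ge0 ?powR_ge0 //; exact: ltW.
    rewrite -!mulrA ler_wpM2l ?exprn_ge0 // exprMn exprVn mulrC.
    rewrite ler_wpM2l ?invr_ge0 ?exprn_ge0 ?(ltW h_gt0) //.
    rewrite -powR_mulrn ?(ltW wi0) // -{1}(subrK s d%:R).
    rewrite powRD; last by rewrite (gt_eqF wi0) implybT.
    rewrite ler_wpM2r ?powR_ge0 // ge0_ler_powR ?nnegrE ?(ltW wi0) ?(ltW ell_gt0) ?subr_ge0 //.
    exact: w_le.
  apply: le_trans (_ : w i `^ s / (eps * rho `^ s) * 9 ^+ d <= _).
    apply: ler_wpM2l; first by rewrite divr_ge0 ?mulr_ge0 ?powR_ge0 // ltW.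
    have : w i / h <= 1 by rewrite ler_pdivrMr // mul1r ltW.
    by move: (w i / h) wh0 => t ? ?; apply: lerXn2r; rewrite ?nnegrE; lra.
  rewrite /A mulrDr mulrDl -[X in X <= _]add0r lerD //; last first.
    by rewrite le_eqVlt; apply/orP; left; apply/eqP; ring.
  by rewrite !mulr_ge0 ?powR_ge0 ?exprn_ge0 ?invr_ge0 ?exprn_ge0 // ltW.
rewrite (eq_bigr (fun g => \sum_(i < n | meets i)
    if near_grid i g then weight i else 0)); last first.
  by move=> g _; rewrite big_mkcondr.
rewrite exchange_big /=.
apply: le_trans (_ : \sum_(i < n | meets i) A * w i `^ s <= _).
  apply: ler_sum => i mi; apply: le_trans (bound i mi).
  rewrite -big_mkcond /= sumr_const -[X in X <= _]mulr_natr.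
  by apply: ler_wpM2l => //; exact: count.
rewrite -mulr_sumr.
apply: le_trans (_ : A * (eps * ell `^ s) <= _).
  apply: ler_wpM2l => //; rewrite /A.
  by rewrite mulr_ge0 ?addr_ge0 ?mulr_ge0 ?invr_ge0 ?exprn_ge0 ?mulr_ge0 ?powR_ge0 // ltW.
(* The factor 36^d = 9^d 4^d in [eps] makes the large balls contribute exactly X^d/4; [rho_large]
   bounds the contribution of the small ones by as much. *)
have -> : A * (eps * ell `^ s) = X ^+ d / 4 + 9 ^+ d * (ell / rho) `^ s.
  rewrite /A mulrDr mulrDl; congr (_ + _).
    have -> : X ^+ d = ell `^ d%:R * h ^- d * 4 ^- d.
      rewrite powR_mulrn ?(ltW ell_gt0) // X_def expr_div_n exprMn invfM.
      by rewrite mulrA mulrAC.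
    rewrite -{2}(subrK s d%:R) (@powRD _ ell (d%:R - s) s);
      last by rewrite (gt_eqF ell_gt0) implybT.
    have -> : eps = 4^-1 * (9 ^- d * 4 ^- d).
      rewrite eps_def invfM; congr (_ * _).
      by rewrite -invfM -exprMn; congr (_ ^- _); lra.
    have : (9 : R) ^+ d != 0 by rewrite expf_neq0.
    have : (4 : R) ^+ d != 0 by rewrite expf_neq0.
    have : h ^+ d != 0 by rewrite expf_neq0 // gt_eqF.
    move: (9 ^+ d) (4 ^+ d) (h ^+ d) => u v t *; field.
    by apply/and3P; split.
  rewrite powRM ?invr_ge0 ?(ltW rho_gt0) ?(ltW ell_gt0) //.
  have -> : rho^-1 `^ s = (rho `^ s)^-1 by rewrite -powRN -[in RHS]mulN1r powRrM powR_inv1 // ltW.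
  rewrite -!mulrA; congr (_ * _).
  by field; rewrite !gt_eqF ?powR_gt0.
have XM : X ^+ d <= m%:R ^+ d by rewrite lerXn2r ?nnegrE // ltW.
by move: rho_large; lra.
Qed.

(* The denominators run from 1 to [N ^ d %/ k], hence the shift [q.+1]. *)
Let near_rational (q : nat) g :=
  [forall j, `[< exists p : int, `|q.+1%:R * grid g j - p%:~R| <= N%:R^-1 >]].

(** For [q >= L] the denominator [q.+1] spoils at most X^d (12/N)^d grid points; over N^d/k
    denominators this adds up to X^d/8 by the choice of [k]. The denominators with [q < L] only
    satisfy a cruder bound, but [N_large] keeps their total below X^d/8 as well. *)
Lemma sum_near_rational :
  \sum_g \sum_(q < N ^ d %/ k | near_rational q g) (1 : R) <= m%:R ^+ d / 4.
Proof.
have count q : (q < N ^ d %/ k)%N -> #|[pred g | near_rational q g]|%:R <=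
    (X * ((6 / N%:R) * (1 + 6 / (ell * q.+1%:R)))) ^+ d.
  move=> qlt.
  (* Multiplied by [q.+1], the grid has mesh at most 1/N, so the [+ 1] in the count of a progression
     is absorbed into its main term. *)
  have qh : N%:R * (q.+1%:R * h) <= 1.
    have : (q.+1%:R * k%:R : R) <= N%:R ^+ d.
      rewrite -natrM -natrX ler_nat.
      by apply: leq_trans (leq_divM (N ^ d) k); rewrite leq_mul2r qlt orbT.
    have -> : N%:R * (q.+1%:R * h) = q.+1%:R * k%:R / N%:R ^+ d.
      by rewrite h_def exprS; field; rewrite expf_neq0 gt_eqF.
    by rewrite ler_pdivrMr ?exprn_gt0 // mul1r.
  have q0 : 0 < q.+1%:R :> R by rewrite ltr0n.
  pose P j := [pred a : 'I_m | `[< exists p : int,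
     `|q.+1%:R * x j + (q.+1%:R * h) * a%:R - p%:~R| <= N%:R^-1 >]].
  have -> : #|[pred g | near_rational q g]| =
      #|[pred g : {ffun 'I_d -> 'I_m} | [forall j, P j (g j)]]|.
    apply: eq_card => g; rewrite !inE; apply: eq_forallb => j /=.
    by rewrite /grid mulrDr mulrA.
  apply: (@card_ffun_pred _ _ _ P) => j.
  have qh0 : 0 < q.+1%:R * h by rewrite mulr_gt0.
  have iN : N%:R^-1 * 2 <= 1 :> R.
    by rewrite mulrC ler_pdivrMr // mul1r (ler_nat _ 2).
  have iN0 : 0 <= N%:R^-1 :> R by rewrite invr_ge0 ltW.
  have iN2 : 2 * N%:R^-1 <= 1 :> R by rewrite mulrC.
  apply: le_trans (card_progression_near_int m (q.+1%:R * x j) _ _ qh0 iN0 iN2) _.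
  have -> : X * ((6 / N%:R) * (1 + 6 / (ell * q.+1%:R))) =
      (q.+1%:R * (ell / 2) + 3) * (3 / (N%:R * (q.+1%:R * h))).
    by rewrite X_def; field; rewrite !gt_eqF.
  apply: ler_pM.
  - by rewrite addr_ge0 // mulr_ge0 // ltW.
  - by rewrite addr_ge0 // divr_ge0 ?mulr_ge0 ?invr_ge0 // ltW.
  - by rewrite lerD2r -mulrA ler_wpM2l // ltW.
  - have : 1 <= (N%:R * (q.+1%:R * h))^-1 by rewrite invf_ge1 // mulr_gt0.
    have -> : 2 / N%:R / (q.+1%:R * h) = 2 * (N%:R * (q.+1%:R * h))^-1.
      by field; rewrite !gt_eqF.
    by move: (N%:R * (q.+1%:R * h))^-1 => t; lra.
rewrite (eq_bigr (fun g => \sum_(q < N ^ d %/ k) if near_rational q g then 1 else 0)); last first.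
  by move=> g _; rewrite big_mkcond.
rewrite exchange_big /=.
pose B := (6 / N%:R : R) ^+ d.
have B0 : 0 <= B by rewrite exprn_ge0 // divr_ge0 // ltW.
apply: le_trans (_ : \sum_(q < N ^ d %/ k)
    (X ^+ d * B * (2 ^+ d + if (q < L)%N then (7 / ell) ^+ d else 0)) <= _).
  apply: ler_sum => q _; rewrite -big_mkcond /= sumr_const.
  apply: le_trans (count q (ltn_ord q)) _.
  rewrite exprMn [(_ * (1 + _)) ^+ d]exprMn -/B mulrA.
  apply: ler_wpM2l; first by rewrite mulr_ge0 ?exprn_ge0 // ltW.
  have q0 : 0 < q.+1%:R :> R by rewrite ltr0n.
  have q1 : 1 <= q.+1%:R :> R by rewrite (ler_nat _ 1).
  have e0 : 0 <= 1 + 6 / (ell * q.+1%:R) by rewrite addr_ge0 // divr_ge0 // mulr_ge0 // ltW.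
  case: ifPn => [ltL|].
    apply: le_trans (_ : (7 / ell) ^+ d <= _); last by rewrite lerDr exprn_ge0.
    rewrite lerXn2r ?nnegrE // ?divr_ge0 ?(ltW ell_gt0) //.
    have -> : 1 + 6 / (ell * q.+1%:R) = (ell + 6 / q.+1%:R) / ell.
      by field; rewrite !gt_eqF.
    rewrite ler_wpM2r ?invr_ge0 ?(ltW ell_gt0) //.
    have : 6 / q.+1%:R <= 6 :> R by rewrite ler_pdivrMr // ler_peMr.
    by move: (6 / q.+1%:R) ell_le1 => t; lra.
  rewrite -leqNgt addr0 => leL.
  rewrite lerXn2r ?nnegrE // -[X in _ <= X]/(1 + 1) lerD2l ler_pdivrMr ?mulr_gt0 // mul1r.
  rewrite -ler_pdivrMl // mulrC.
  have /truncn_itv/andP[_ /ltW lt] : 0 <= 6 / ell by rewrite divr_ge0 // ltW.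
  by apply: le_trans lt _; rewrite -L_def ler_nat; apply: leqW.
rewrite -mulr_sumr big_split /= sumr_const card_ord.
apply: le_trans (_ : X ^+ d * B * (N%:R ^+ d / k%:R * 2 ^+ d + L%:R * (7 / ell) ^+ d) <= _).
  rewrite ler_wpM2l ?mulr_ge0 ?exprn_ge0 ?(ltW X_gt0) // lerD //.
    rewrite -[X in X <= _]mulr_natl ler_wpM2r ?exprn_ge0 // ler_pdivlMr ?ltr0n //.
    by rewrite -natrM -natrX ler_nat leq_divM.
  rewrite -big_mkcond /= sumr_const -[X in X <= _]mulr_natl
    ler_wpM2r ?exprn_ge0 ?divr_ge0 ?(ltW ell_gt0) //.
  have LS : L = L.-1.+1 by rewrite L_def.
  rewrite ler_nat; have inj : {in [pred q : 'I_(N ^ d %/ k) | (q < L)%N] &,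
      injective (fun q : 'I_(N ^ d %/ k) => inord q : 'I_L.-1.+1)}.
    move=> q r; rewrite !inE LS => hq hr /(congr1 (val : 'I_L.-1.+1 -> nat)) /=.
    by rewrite !inordK // => e; apply/val_inj.
  by have := leq_card_in _ _ inj; rewrite card_ord -LS.
have XM : X ^+ d <= m%:R ^+ d by rewrite lerXn2r ?nnegrE // ltW.
apply: le_trans (_ : X ^+ d * (1 / 4) <= _); last by lra.
rewrite -mulrA ler_wpM2l ?exprn_ge0 ?(ltW X_gt0) // mulrDr.
have -> : B * (N%:R ^+ d / k%:R * 2 ^+ d) = 1 / 8.
  have -> : k%:R = 8 * (6 ^+ d * 2 ^+ d) :> R.
    by rewrite k_def natrM natrX -exprMn -natrM.
  rewrite /B exprMn exprVn; field.
  by rewrite !expf_neq0 ?gt_eqF.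
have : B * (L%:R * (7 / ell) ^+ d) <= 1 / 8; last by lra.
rewrite /B [(6 / _) ^+ _]exprMn exprVn mulrAC ler_pdivrMr ?exprn_gt0 //.
by move: N_large; lra.
Qed.

(** The two sums over the grid add up to at most three quarters of the number of grid points, so
    some grid point has total weight below 1. *)
Lemma exists_good_point : exists y : 'I_d -> R, [/\ forall j, `|y j - x j| <= ell / 2,
  forall n, \sum_(i < n | meets i && [forall j, `|y j - c i j| <= 3 * h + w i]) w i `^ s
    <= eps * rho `^ s &
  forall q, (0 < q <= N ^ d %/ k)%N ->
    ~ forall j, exists p : int, `|q%:R * y j - p%:~R| <= N%:R^-1].
Proof.
pose F n g := \sum_(i < n | meets i && near_grid i g) weight i +
  \sum_(q < N ^ d %/ k | near_rational q g) 1.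
have some_good n : exists g, F n g < 1.
  apply: exists_lt1_of_sum; rewrite card_ffun !card_ord natrX big_split /=.
  have m0 : 0 < m%:R ^+ d :> R by rewrite exprn_gt0 // (lt_le_trans X_gt0).
  by have := sum_weight_near_grid n; have := sum_near_rational; lra.
have Fmono n n' g : (n <= n')%N -> F n g <= F n' g.
  move=> le; rewrite lerD2r -(subnKC le) big_split_ord /= lerDl.
  by apply: sumr_ge0 => *; exact: weight_ge0.
(* One grid point must serve all [n]. [F n g] grows with [n] and the grid is finite: if each grid
   point failed at some [n], all would fail at the largest of these. *)
have [g Fg] : exists g, forall n, F n g < 1.
  apply: contrapT => /forallNP bad.
  have {}bad g : exists n, 1 <= F n g.
    have /existsNP[n] := bad g.
    by move=> /negP; rewrite -leNgt => ?; exists n.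
  have [f fP] := choice bad.
  have [g] := some_good (\max_g f g)%N.
  rewrite ltNge => /negP; apply.
  by apply: le_trans (fP g) (Fmono _ _ _ _); exact: leq_bigmax.
have S2 : 0 <= \sum_(q < N ^ d %/ k | near_rational q g) (1 : R).
  exact: sumr_ge0.
have S1 n : 0 <= \sum_(i < n | meets i && near_grid i g) weight i.
  by apply: sumr_ge0 => *; exact: weight_ge0.
exists (grid g); split.
- move=> j; rewrite /grid addrC addKr ger0_norm ?mulr_ge0 ?(ltW h_gt0) //.
  by apply: le_trans m_le; rewrite ler_wpM2l ?(ltW h_gt0) // ler_nat ltnW.
- move=> n.
  have er0 : 0 < eps * rho `^ s by rewrite mulr_gt0 ?powR_gt0.
  have small i : (i < n)%N -> meets i && near_grid i g ->
      weight i = w i `^ s / (eps * rho `^ s).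
    move=> lt hi; rewrite /weight; case: ifP => // le.
    have := Fg n; rewrite /F (bigD1 (Ordinal lt)) //= {1}/weight le.
    suff : 0 <= \sum_(j < n | meets j && near_grid j g && (j != Ordinal lt)) weight j.
      by lra.
    by apply: sumr_ge0 => *; exact: weight_ge0.
  rewrite -[X in _ <= X]mul1r -ler_pdivrMr // mulr_suml.
  apply: le_trans (_ : \sum_(i < n | meets i && near_grid i g) weight i <= _).
    by apply: ler_sum => i hi; rewrite (small i).
  by have := Fg n; rewrite /F; lra.
- case=> // q /= lt near.
  have := Fg 0%N; rewrite /F (bigD1 (Ordinal lt)) /=; last first.
    by apply/forallP => j; apply/asboolP.
  suff : 0 <= \sum_(r < N ^ d %/ k | near_rational r g && (r != Ordinal lt)) (1 : R).
    by have := S1 0%N; lra.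
  exact: sumr_ge0.
Qed.

End GoodPoint.

(** * Choice of the scale [N] and of the light sub-box *)

Lemma le_powR_near_infty {R : realType} (C a : R) : 0 < a ->
  \forall N \near \oo, C <= N%:R `^ a.
Proof.
move=> a0; near=> N.
apply: le_trans (_ : Num.max C 1 <= _); first by rewrite le_max lexx.
have M0 : 0 <= Num.max C 1 by rewrite le_max ler01 orbT.
have -> : Num.max C 1 = (Num.max C 1 `^ a^-1) `^ a.
  by rewrite -powRrM mulVf ?gt_eqF // powRr1.
apply: ge0_ler_powR; rewrite ?nnegrE ?powR_ge0 ?(ltW a0) //.
near: N; exact: nbhs_infty_ger.
Unshelve. all: by end_near. Qed.

(** Up to constants, [h] is N^(-d-1), while [rho] and the shift towards the target are
    N^(-d(1+eta)), of smaller order because d eta > 1. The condition involving [s] compares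
    N^(d(1+eta)s) with N^(d(d+1)). Hence every large [N] works. *)
Lemma exists_large_scale {R : realType} (d k : nat) (eta s ell tau V : R) :
  (0 < d)%N -> d%:R^-1 < eta -> (1 + eta) * s < d.+1%:R -> (0 < k)%N ->
  0 < ell -> 0 < tau ->
  exists N : nat, let h : R := k%:R / N%:R ^+ d.+1 in let rho := tau / (N%:R ^+ d) `^ (1 + eta) in
  [/\ (1 < N)%N, 8 * h <= ell,
    8 * 6 ^+ d * (Num.truncn (6 / ell)).+1%:R * (7 / ell) ^+ d <= N%:R ^+ d,
    9 ^+ d * (ell / rho) `^ s <= (ell / (4 * h)) ^+ d / 4 &
    rho <= h /\ V * (N%:R ^+ d / k%:R) `^ (- (1 + eta)) <= h].
Proof.
move=> d_gt0 eta_gt s_lt k_nat_gt0 ell0 tau0.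
have dR_gt0 : 0 < d%:R :> R by rewrite ltr0n.
have deta : 1 < d%:R * eta by rewrite mulrC -ltr_pdivrMr // div1r.
have k_gt0 : 0 < k%:R :> R by rewrite ltr0n.
have de0 : 0 < d%:R * eta - 1 by move: deta; lra.
pose C4 := (9 ^+ d * (ell / tau) `^ s) / ((ell / (4 * k%:R)) ^+ d / 4).
pose C6 := V * k%:R `^ (1 + eta) / k%:R.
have e4 : 0 < d%:R * (d.+1%:R - (1 + eta) * s) by rewrite mulr_gt0 // subr_gt0.
have [N [N1 [H2 [H3 [H4 [H5 H6]]]]]] := filter_ex (filterI (nbhs_infty_gt 1)
  (filterI (le_powR_near_infty (8 * k%:R / ell) _ (ltr0Sn R d))
  (filterI (le_powR_near_infty (8 * 6 ^+ d * (Num.truncn (6 / ell)).+1%:R * (7 / ell) ^+ d)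
    _ dR_gt0)
  (filterI (le_powR_near_infty C4 _ e4)
  (filterI (le_powR_near_infty (tau / k%:R) _ de0) (le_powR_near_infty C6 _ de0)))))).
exists N => h rho.
have N0 : 0 < N%:R :> R by rewrite ltr0n; exact: ltnW N1.
have powN n : N%:R ^+ n = N%:R `^ n%:R :> R by rewrite powR_mulrn // ltW.
have Nd0 : 0 < N%:R ^+ d :> R by rewrite exprn_gt0.
have NT : (N%:R ^+ d) `^ (1 + eta) = N%:R `^ (d%:R * eta - 1) * N%:R ^+ d.+1 :> R.
  rewrite !powN -powRrM -powRD; last by rewrite (gt_eqF N0) implybT.
  by congr (_ `^ _); rewrite -natr1; ring.
have T0 : 0 < (N%:R ^+ d) `^ (1 + eta) :> R by rewrite powR_gt0.
split => //.
- rewrite /h mulrA ler_pdivrMr ?exprn_gt0 // [X in _ <= X]mulrC -ler_pdivrMr // powN.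
  exact: H2.
- by rewrite [X in _ <= X]powN.
- have -> : ell / rho = (ell / tau) * (N%:R ^+ d) `^ (1 + eta).
    by rewrite /rho; field; rewrite !gt_eqF.
  have -> : ell / (4 * h) = (ell / (4 * k%:R)) * N%:R ^+ d.+1.
    by rewrite /h; field; rewrite expf_neq0 ?gt_eqF.
  rewrite powRM ?powR_ge0 ?divr_ge0 ?(ltW ell0) ?(ltW tau0) // exprMn -exprM.
  have -> : N%:R ^+ (d.+1 * d) =
      N%:R `^ (d%:R * (d.+1%:R - (1 + eta) * s)) * ((N%:R ^+ d) `^ (1 + eta)) `^ s :> R.
    rewrite !powN -!powRrM -powRD; last by rewrite (gt_eqF N0) implybT.
    by congr (_ `^ _); rewrite natrM; ring.
  rewrite mulrA [X in _ <= X]mulrAC mulrA ler_wpM2r ?powR_ge0 //.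
  rewrite [X in _ <= X]mulrC -ler_pdivrMr //.
  by rewrite divr_gt0 ?exprn_gt0 ?divr_gt0 ?mulr_gt0.
split.
- rewrite /rho /h NT invfM mulrA ler_wpM2r ?invr_ge0 ?exprn_ge0 ?(ltW N0) //.
  by rewrite ler_pdivrMr ?powR_gt0 // [X in _ <= X]mulrC -ler_pdivrMr.
- rewrite powRN powRM ?invr_ge0 ?(ltW Nd0) ?(ltW k_gt0) // NT.
  have -> : k%:R^-1 `^ (1 + eta) = (k%:R `^ (1 + eta))^-1 :> R.
    by rewrite -powRN -[in RHS]mulN1r powRrM powR_inv1 // ltW.
  set K := k%:R `^ (1 + eta).
  have K0 : 0 < K by rewrite powR_gt0.
  have P0 : 0 < N%:R `^ (d%:R * eta - 1) :> R by rewrite powR_gt0.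
  have M0 : 0 < N%:R ^+ d.+1 :> R by rewrite exprn_gt0.
  have -> : V / (N%:R `^ (d%:R * eta - 1) * N%:R ^+ d.+1 / K) =
     (V * K / N%:R `^ (d%:R * eta - 1)) / N%:R ^+ d.+1.
    by field; rewrite !gt_eqF.
  rewrite /h ler_wpM2r ?invr_ge0 ?(ltW M0) //.
  by rewrite ler_pdivrMr // [X in _ <= X]mulrC -ler_pdivrMr.
Qed.

(** The index condition says that the sup-norm box of radius [ell] at [x] meets the one of radius
    [w i] at [c i]. Bounding all partial sums stands for bounding the series. *)
Definition light_box {R : realType} {d : nat} (c : nat -> 'I_d -> R) (w : nat -> R)
    (s eps : R) (x : 'I_d -> R) (ell : R) :=
  forall n, \sum_(i < n | [forall j, `|x j - c i j| <= ell + w i]) w i `^ s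
    <= eps * ell `^ s.

(* [w i] is the radius of the ball centred at [c i]; [(4 * 36 ^+ d)^-1] makes the
   balls larger than the mesh count for at most a quarter of the grid points. *)
Lemma exists_light_subbox {R : realType} (d : nat) (eta s : R)
    (c : nat -> 'I_d -> R) (w : nat -> R) (eps : R := (4 * 36 ^+ d)^-1)
    (x : 'I_d -> R) (ell : R) (v : 'I_d -> R) (tau : R) :
  (0 < d)%N -> d%:R^-1 < eta -> 0 < s -> (1 + eta) * s < d.+1%:R ->
  (forall i, 0 < w i) -> 0 < ell -> ell <= 1 -> 0 < tau ->
  light_box c w s eps x ell ->
  exists (x' : 'I_d -> R) (rho : R), [/\ 0 < rho, rho <= ell / 2,
    light_box c w s eps x' rho, (forall j, `|x' j - x j| <= ell - rho) &
    exists (q : nat) (p : 'I_d -> int), (0 < q)%N /\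
      forall a : 'I_d -> R, (forall j, `|a j - x' j| <= rho) ->
        forall j, `|q%:R `^ eta * (q%:R * a j - (p j)%:~R) - v j| <= tau].
Proof.
move=> d0 eta_gt s0 s_lt w0 ell0 ell1 tau0 light.
have dR0 : 0 < d%:R :> R by rewrite ltr0n.
have deta : 1 < d%:R * eta by rewrite mulrC -ltr_pdivrMr // div1r.
have eta0 : 0 < eta by apply: le_lt_trans eta_gt; rewrite invr_ge0.
(* Since d eta > 1, (1 + eta) d exceeds d + 1. *)
have s_le : s <= d%:R.
  rewrite -(ler_pM2l (_ : 0 < 1 + eta)); last by rewrite addr_gt0.
  by apply: le_trans (ltW s_lt) _; rewrite -natr1 mulrDl mul1r; move: deta; lra.
have [k kE] : exists k, k = (8 * 12 ^ d)%N by eexists.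
have k_nat0 : (0 < k)%N by rewrite kE muln_gt0 expn_gt0.
have k0 : 0 < k%:R :> R by rewrite ltr0n.
pose V : R := \sum_j `|v j|.
have VP j : `|v j| <= V by rewrite /V (bigD1 j) //= lerDl sumr_ge0.
have [N [N1 h_le N_large rho_large [rho_le shift_le]]] :=
  exists_large_scale _ _ _ _ _ _ V d0 eta_gt s_lt k_nat0 ell0 tau0.
set h := k%:R / N%:R ^+ d.+1 in h_le rho_large rho_le shift_le.
set T := (N%:R ^+ d) `^ (1 + eta) in rho_large rho_le.
set rho := tau / T in rho_large rho_le.
have N0 : 0 < N%:R :> R by rewrite ltr0n; exact: ltnW N1.
have Nd0 : 0 < N%:R ^+ d :> R by rewrite exprn_gt0.
have T0 : 0 < T by rewrite powR_gt0.
have rho0 : 0 < rho by rewrite divr_gt0.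
have h0 : 0 < h by rewrite divr_gt0 // exprn_gt0.
have [y [yx light_y irr]] := @exists_good_point R d N k s ell rho x c w eps h _ _ _
  erefl erefl erefl erefl erefl N1 kE
  s0 s_le ell0 ell1 rho0 w0 h_le N_large rho_large light.
have [q [p [q0 qN qp]]] := dirichlet _ y _ (ltnW N1).
(* The choice of [y] rules out the small denominators. *)
have qk : (N ^ d %/ k < q)%N.
  rewrite ltnNge; apply/negP => le; apply: (irr q); first by rewrite q0 le.
  by move=> j; exists (p j).
have qR0 : 0 < q%:R :> R by rewrite ltr0n.
have qlow : N%:R ^+ d / k%:R <= q%:R :> R.
  rewrite ler_pdivrMr // -natrX -natrM ler_nat ltnW // -ltn_divLR //.
(* The solution [a] of q^eta (q a - p) = v. It lies within [2 * h] of [y]: one [h] for the distance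
   from [y] to p/q, one for the shift by [v]. *)
pose x' j := ((p j)%:~R + q%:R `^ (- eta) * v j) / q%:R.
have yx' j : `|x' j - y j| <= 2 * h.
  have -> : x' j - y j = - (q%:R * y j - (p j)%:~R) / q%:R + v j * (q%:R `^ (- (1 + eta))).
    rewrite [- (1 + eta)]opprD powRD; last by rewrite (gt_eqF qR0) implybT.
    rewrite powR_inv1 ?(ltW qR0) // /x'; field; by rewrite gt_eqF.
  apply: le_trans (ler_normD _ _) _; rewrite [2 * h]mulrDl mul1r lerD //.
    rewrite normrM normrN normfV (ger0_norm (ltW qR0)).
    apply: le_trans (_ : N%:R^-1 * (N%:R ^+ d / k%:R)^-1 <= _).
      apply: ler_pM; rewrite ?invr_ge0 ?qp // lef_pV2 ?posrE //.
      by rewrite divr_gt0.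
    by rewrite invf_div mulrC -mulrA -invfM -exprSr.
  apply: le_trans shift_le.
  rewrite normrM ler_pM // ger0_norm ?powR_ge0 //.
  rewrite !powRN lef_pV2 ?posrE ?powR_gt0 ?divr_gt0 //.
  by rewrite ge0_ler_powR ?nnegrE ?addr_ge0 ?divr_ge0 // ltW.
exists x', rho; split => //.
- by move: rho_le h_le h0; lra.
(* A ball meeting the box at [x'] comes within [3 * h] of [y], because [rho <= h], and meets the old
   box, because [8 * h <= ell]. So its mass is already counted at [y]. *)
- move=> n; apply: le_trans (light_y n).
  rewrite big_mkcond [X in _ <= X]big_mkcond /=; apply: ler_sum => i _.
  case: ifP => [/forallP near|_]; last by case: ifP => _; rewrite ?powR_ge0.
  suff -> : [forall j, `|x j - c i j| <= ell + w i] &&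
    [forall j, `|y j - c i j| <= 3 * h + w i] by [].
  apply/andP; split; apply/forallP => j; have := near j; have := yx' j; have := yx j;
    rewrite !ler_norml => /andP[? ?] /andP[? ?] /andP[? ?]; apply/andP; split;
    by move: rho_le h_le h0; lra.
- move=> j; have := yx' j; have := yx j.
  rewrite !ler_norml => /andP[? ?] /andP[? ?]; apply/andP; split;
    by move: rho_le h_le h0; lra.
exists q, p; split => // a aP j.
have -> : q%:R `^ eta * (q%:R * a j - (p j)%:~R) - v j = q%:R `^ (1 + eta) * (a j - x' j).
  rewrite powRD ?(gt_eqF qR0) ?implybT // powRr1 ?(ltW qR0) // /x' powRN.
  by field; rewrite !gt_eqF // powR_gt0.
rewrite normrM ger0_norm ?powR_ge0 //.
apply: le_trans (_ : T * rho <= _); last by rewrite /rho mulrC divfK // gt_eqF.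
apply: ler_pM; rewrite ?powR_ge0 //.
rewrite ge0_ler_powR ?nnegrE ?addr_ge0 ?(ltW eta0) ?(ltW Nd0) ?(ltW qR0) //.
by rewrite -natrX ler_nat.
Qed.

(** * A point of D(eta) outside small balls *)

(** In each coordinate, every lower endpoint is below every upper endpoint, so the supremum of the
    lower endpoints lies in all the intervals. *)
Lemma nested_boxes {R : realType} (d : nat) (x : nat -> 'I_d -> R) (r : nat -> R) :
  (forall n, 0 <= r n) -> (forall n j, `|x n.+1 j - x n j| <= r n - r n.+1) ->
  exists a : 'I_d -> R, forall n j, `|a j - x n j| <= r n.
Proof.
move=> r0 step.
have far n m j : `|x (n + m)%N j - x n j| <= r n - r (n + m)%N.
  elim: m => [|m IH]; first by rewrite addn0 !subrr normr0.
  rewrite addnS; have := step (n + m)%N j; move: IH.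
  by rewrite !ler_norml => /andP[? ?] /andP[? ?]; apply/andP; split; lra.
have cross n m j : x n j - r n <= x m j + r m.
  have [le|/ltnW le] := leqP n m.
    have := far n (m - n)%N j; rewrite subnKC // ler_norml => /andP[? ?].
    by have := r0 m; have := r0 n; lra.
  have := far m (n - m)%N j; rewrite subnKC // ler_norml => /andP[? ?].
  by have := r0 m; have := r0 n; lra.
pose A j := range (fun n => x n j - r n).
exists (fun j => sup (A j)) => n j.
have ubA : ubound (A j) (x n j + r n) by move=> _ [m _ <-].
have le1 : x n j - r n <= sup (A j).
  by apply: ub_le_sup; [exists (x n j + r n) | exists n].
have le2 : sup (A j) <= x n j + r n.
  by apply: ge_sup => //; exists (x n j - r n); exists n.
by rewrite ler_norml; apply/andP; split; lra.
Qed.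

Lemma dense_NA_Dset {R : realType} (d : nat) (eta : R) (a : 'rV[R]_d) : (0 < d)%N ->
  (forall (v : 'I_d -> rat) (k : nat), exists (q : nat) (p : 'I_d -> int), (0 < q)%N /\
     forall j, `|q%:R `^ eta * (q%:R * a ord0 j - (p j)%:~R) - ratr (v j)| <= k.+1%:R^-1) ->
  Dset eta a.
Proof.
move=> d0 dense; rewrite /Dset /= /Acc; apply/seteqP; split => // t _ U /nbhs_ballP[e /= e0 eU].
(* The target sits in the middle third of (t_j, t_j + e): an error below e/3 then keeps the
   approximating point within [e] of [t] and distinct from it, as accumulation demands. *)
have vex j : exists q : rat, t ord0 j + e / 3 < ratr q < t ord0 j + 2 * e / 3.
  have lt : t ord0 j + e / 3 < t ord0 j + 2 * e / 3 by lra.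
  by have [q] := rat_in_itvoo lt; rewrite in_itv /=; exists q.
have [v vP] := choice vex.
pose k := Num.truncn (3 / e).
have kP : k.+1%:R^-1 < e / 3.
  have /truncn_itv/andP[_ lt] : 0 <= 3 / e by rewrite divr_ge0 // ltW.
  by rewrite -[e / 3]invf_div ltf_pV2 ?posrE ?divr_gt0.
have [q [p [q0 qp]]] := dense v k.
pose y : 'rV[R]_d := (q%:R `^ eta) *: (q%:R *: a - \row_j (p j)%:~R).
have yP j : t ord0 j < y ord0 j < t ord0 j + e.
  have := qp j; rewrite ler_norml => /andP[h1 h2].
  have /andP[h3 h4] := vP j.
  rewrite /y !mxE; move: kP h1 h2 h3 h4.
  move: (ratr (v j)) (_ `^ eta * _) (k.+1%:R^-1) => V Y K ? ? ? ? ?.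
  by apply/andP; split; lra.
exists y; split.
- apply/eqP => yt; have /andP[] := yP (Ordinal d0).
  by rewrite yt ltxx.
- exists q%:Z, (\row_j p j); split; first by rewrite eqz_nat -lt0n.
  rewrite ger0_norm // /y; congr (_ *: (_ - _)).
  by apply/matrixP => i j; rewrite !mxE.
- apply: eU; split => // i j; rewrite ord1 /ball /=.
  have /andP[? ?] := yP j; rewrite distrC ger0_norm ?subr_ge0; lra.
Qed.

Lemma Dset_avoids {R : realType} (d : nat) (eta s : R) (c : nat -> 'I_d -> R) (w : nat -> R) :
  (0 < d)%N -> d%:R^-1 < eta -> 0 < s -> (1 + eta) * s < d.+1%:R ->
  (forall i, 0 < w i) ->
  (forall n, \sum_(i < n) w i `^ s <= (4 * 36 ^+ d)^-1) ->
  exists a : 'rV[R]_d, Dset eta a /\ forall i, exists j, w i < `|a ord0 j - c i j|.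
Proof.
move=> d0 eta_gt s0 s_lt w0 sum_le.
set eps : R := (4 * 36 ^+ d)^-1 in sum_le.
have eps0 : 0 < eps by rewrite invr_gt0 mulr_gt0 ?exprn_gt0.
pose good (b : ('I_d -> R) * R) := [/\ 0 < b.2, b.2 <= 1 & light_box c w s eps b.1 b.2].
pose box := {b | good b}.
(* An enumeration of all pairs of a rational vector and a precision; numbers coding no pair get a
   default one. *)
pose target n : ('I_d -> rat) * nat :=
  if @unpickle ({ffun 'I_d -> rat} * nat)%type n is Some fk then (fun_of_fin fk.1, fk.2)
    else (fun=> 0, 0%N).
pose refines n (b b' : box) := [/\ (sval b').2 <= (sval b).2 / 2,
  forall j, `|(sval b').1 j - (sval b).1 j| <= (sval b).2 - (sval b').2 &
  exists (q : nat) (p : 'I_d -> int), (0 < q)%N /\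
    forall a : 'I_d -> R, (forall j, `|a j - (sval b').1 j| <= (sval b').2) ->
      forall j, `|q%:R `^ eta * (q%:R * a j - (p j)%:~R) - ratr ((target n).1 j)|
        <= (target n).2.+1%:R^-1].
have step (nb : nat * box) : exists b', refines nb.1 nb.2 b'.
  case: nb => n [[x ell] /= [ell0 ell1 light]].
  have t0 : 0 < (target n).2.+1%:R^-1 :> R by rewrite invr_gt0.
  have [x' [rho [rho0 rho_le light' near hit]]] :=
    exists_light_subbox _ _ _ _ _ _ _ (fun j => ratr ((target n).1 j)) _
      d0 eta_gt s0 s_lt w0 ell0 ell1 t0 light.
  have gb : good (x', rho) by split => //=; lra.
  by exists (exist _ (x', rho) gb); split.
have [f fP] := choice step.
(* The starting box is light because even all the balls together have mass at most [eps]. *)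
have g0 : good (fun=> 0, 1).
  split => //= n; rewrite powR1 mulr1; apply: le_trans (sum_le n).
  by rewrite big_mkcond /=; apply: ler_sum => i _; case: ifP => _; rewrite ?powR_ge0.
pose b := fix b n := if n is n'.+1 then f (n', b n') else exist good (fun=> 0, 1) g0.
have bP n : refines n (b n) (b n.+1) := fP (n, b n).
pose x n := (sval (b n)).1; pose r n := (sval (b n)).2.
have r0 n : 0 < r n by have [] := svalP (b n).
have r_half n : r n <= 2 ^- n.
  elim: n => [|n IH]; first by rewrite expr0 invr1.
  have [le _ _] := bP n; apply: le_trans le _.
  by rewrite exprSr invfM ler_wpM2r // invr_ge0.
have [a aP] : exists a : 'I_d -> R, forall n j, `|a j - x n j| <= r n.
  apply: nested_boxes => [n|n j]; first exact: ltW.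
  by have [_ + _] := bP n; apply.
exists (\row_j a j); split.
  apply: dense_NA_Dset => // v k.
  have [_ _ [q [p [q0 qp]]]] := bP (pickle ([ffun j => v j], k)).
  exists q, p; split => // j; have := qp a (aP _) j.
  by rewrite mxE /target pickleK /= ffunE.
move=> i; apply: contrapT => /forallNP far.
have {}far j : `|a j - c i j| <= w i.
  by have /negP := far j; rewrite -leNgt mxE.
(* A ball containing the limit point meets every box, so lightness bounds its radius by a multiple
   of [r n], which tends to 0. *)
have small n : w i `^ s <= eps * r n `^ s.
  have [_ _ light] := svalP (b n); apply: le_trans (light i.+1).
  rewrite (bigD1 ord_max) /=.
    by rewrite lerDl; apply: sumr_ge0 => *; exact: powR_ge0.
  apply/forallP => j; rewrite -/(x n) -/(r n).
  have := far j; have := aP n j; rewrite !ler_norml => /andP[? ?] /andP[? ?].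
  by apply/andP; split; lra.
have w_small n : w i <= eps `^ s^-1 * 2 ^- n.
  have : (w i `^ s) `^ s^-1 <= (eps * r n `^ s) `^ s^-1.
    by rewrite ge0_ler_powR ?nnegrE ?invr_ge0 ?mulr_ge0 ?powR_ge0 ?(ltW s0) ?(ltW eps0).
  rewrite powRM ?powR_ge0 ?(ltW eps0) // -!powRrM divff ?gt_eqF //
    !powRr1 ?(ltW (w0 _)) ?(ltW (r0 _)) //.
  by move/le_trans; apply; rewrite ler_wpM2l ?powR_ge0.
have E0 : 0 < eps `^ s^-1 by rewrite powR_gt0.
have := w_small (Num.truncn (eps `^ s^-1 / w i)).+1.
set n := Num.truncn _.
have /truncn_itv/andP[_ lt] : 0 <= eps `^ s^-1 / w i by rewrite divr_ge0 // ltW.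
rewrite leNgt => /negP; apply.
rewrite ltr_pdivrMr ?exprn_gt0 // mulrC -ltr_pdivrMr //.
apply: lt_le_trans lt _; rewrite -/n -natrX ler_nat.
exact: ltnW (ltn_expl _ _).
Qed.

(** * Lower bound for the dimension *)

Section Hausdorff.
Context {R : realType} {d : nat}.
Implicit Types (x y : 'rV[R]_d) (U A : set 'rV[R]_d) (s : R).

Lemma coord_le_edist x y j : `|x ord0 j - y ord0 j| <= Defs.edist x y.
Proof.
rewrite -sqrtr_sqr; apply: ler_wsqrtr.
by rewrite (bigD1 j) //= lerDl; apply: sumr_ge0 => *; exact: sqr_ge0.
Qed.

Lemma edist_le_coord x y r : 0 <= r ->
  (forall j, `|x ord0 j - y ord0 j| <= r) -> Defs.edist x y <= d%:R * r.
Proof.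
move=> r0 xy; rewrite -(@ger0_norm _ (d%:R * r)) ?mulr_ge0 // -sqrtr_sqr.
apply: ler_wsqrtr; apply: le_trans (_ : \sum_(i < d) r ^+ 2 <= _).
  by apply: ler_sum => j _; rewrite -real_normK ?num_real // lerXn2r ?nnegrE.
rewrite sumr_const card_ord -[X in X <= _]mulr_natl exprMn ler_wpM2r ?sqr_ge0 //.
by rewrite -natrX ler_nat; case: (d) => // n; rewrite expnS leq_pmulr.
Qed.

Lemma ediam_ge0 U : (0 <= ediam U)%E.
Proof. by apply: ereal_sup_ubound; left. Qed.

Lemma edist_le_ediam U x y : U x -> U y -> ((Defs.edist x y)%:E <= ediam U)%E.
Proof. by move=> Ux Uy; apply: ereal_sup_ubound; right; exists x => //; exists y. Qed.

Lemma ediam_le U (r : R) : 0 <= r -> (forall x y, U x -> U y -> Defs.edist x y <= r) ->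
  (ediam U <= r%:E)%E.
Proof.
move=> r0 Ur; apply: ge_ereal_sup => _ [->|[x Ux [y Uy <-]]]; rewrite lee_fin //.
exact: Ur.
Qed.

Lemma ediam_set0 : ediam (set0 : set 'rV[R]_d) = 0%E.
Proof. by apply/eqP; rewrite eq_le ediam_ge0 ediam_le. Qed.

Lemma hterm_ge0 s U : (0 <= hterm s U)%E.
Proof. by rewrite /hterm; case: ifP => // _; exact: poweR_ge0. Qed.

Lemma hterm_le s U (r : R) : 0 <= s -> 0 <= r -> (ediam U <= r%:E)%E ->
  (hterm s U <= (r `^ s)%:E)%E.
Proof.
move=> s0 r0; rewrite /hterm; case: ifP => _; first by rewrite lee_fin powR_ge0.
move: (ediam_ge0 U); case: (ediam U) => //= t; rewrite !lee_fin => t0 tr.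
by rewrite ge0_ler_powR ?nnegrE.
Qed.

End Hausdorff.

Lemma sum_half_le1 {R : realType} n : \sum_(i < n) (2 : R) ^- i.+1 <= 1.
Proof.
suff -> : \sum_(i < n) (2 : R) ^- i.+1 = 1 - 2 ^- n by rewrite gerBl invr_ge0 exprn_ge0.
elim: n => [|n IH]; first by rewrite big_ord0 expr0 invr1 subrr.
by rewrite big_ord_recr /= IH exprS invfM; lra.
Qed.

(** Measure zero would give a cover with small s-sum; enclosing its members in balls and applying
    [Dset_avoids] yields a point of the set that is not covered. *)
Lemma hausdorff_measure_Dset_neq0 {R : realType} (d : nat) (eta s : R) :
  (0 < d)%N -> d%:R^-1 < eta -> 0 <= s -> (1 + eta) * s < d.+1%:R ->
  hausdorff_measure s (@Dset R d eta) <> 0%E.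
Proof.
move=> d0 eta_gt s0 s_lt H0.
have eta1 : 0 < 1 + eta.
  by rewrite addr_gt0 //; apply: le_lt_trans eta_gt; rewrite invr_ge0.
(* The midpoint between [s] and the critical exponent is positive even when [s = 0], as
   [Dset_avoids] requires. *)
pose s1 := (s + d.+1%:R / (1 + eta)) / 2.
have s_lt' : s < d.+1%:R / (1 + eta) by rewrite ltr_pdivlMr // mulrC.
have s_s1 : s <= s1 by rewrite /s1; lra.
have s1_gt0 : 0 < s1 by rewrite divr_gt0 // ltr_wpDl // divr_gt0.
have s1_lt : (1 + eta) * s1 < d.+1%:R by rewrite mulrC -ltr_pdivlMr // /s1; lra.
pose eps : R := (4 * 36 ^+ d)^-1.
have eps0 : 0 < eps by rewrite invr_gt0 mulr_gt0 ?exprn_gt0.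
(* At scale 1 all diameters are at most 1, so passing from [s] to the larger exponent [s1] does not
   increase the sum. *)
have : (hausdorff_delta s 1 (@Dset R d eta) < (eps / 2)%:E)%E.
  apply: (@le_lt_trans _ _ 0%E); last by rewrite lte_fin divr_gt0.
  rewrite -H0; apply: ereal_sup_ubound; exists 1 => //=; exact: ltr01.
move=> /ereal_inf_lt[_ [U [UD Udiam] <-] Usum].
pose D i := fine (ediam (U i)).
have DE i : ediam (U i) = (D i)%:E.
  rewrite fineK // ge0_fin_numE ?ediam_ge0 //.
  by apply: le_lt_trans (Udiam i) _; rewrite ltry.
have D0 i : 0 <= D i by rewrite -lee_fin -DE ediam_ge0.
have D1 i : D i <= 1 by rewrite -lee_fin -DE.
have cex i : exists x : 'rV[R]_d, U i !=set0 -> U i x.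
  by have [[x Ux]|U0] := pselect (U i !=set0); [exists x | exists 0].
have [c cP] := choice cex.
pose e i : R := eps / 2 * 2 ^- i.+1.
have e0 i : 0 < e i by rewrite mulr_gt0 ?divr_gt0 // invr_gt0 exprn_gt0.
(* Enlarging the diameters by a summable amount makes the radii positive, so
   that one-point sets of the cover are also avoided. *)
pose w i := (D i `^ s1 + e i) `^ s1^-1.
have we0 i : 0 < D i `^ s1 + e i by rewrite ltr_wpDl ?powR_ge0.
have wE i : w i `^ s1 = D i `^ s1 + e i.
  by rewrite /w -powRrM mulVf ?gt_eqF // powRr1 // ltW.
have w0 i : 0 < w i by rewrite powR_gt0.
have Dw i : D i <= w i.
  have -> : D i = (D i `^ s1) `^ s1^-1 by rewrite -powRrM divff ?gt_eqF // powRr1.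
  by rewrite ge0_ler_powR ?nnegrE ?powR_ge0 ?invr_ge0 ?(ltW s1_gt0) ?(ltW (we0 _)) // lerDl ltW.
have Dterm i : ((D i `^ s1)%:E <= hterm s (U i))%E.
  rewrite /hterm; case: ifPn => [/asboolP U0|_].
    by rewrite /D U0 ediam_set0 /= powR0 // gt_eqF.
  rewrite DE /= lee_fin.
  have [->|Dn0] := eqVneq (D i) 0; first by rewrite (powR0 (lt0r_neq0 s1_gt0)) powR_ge0.
  by apply: ger_powR => //; rewrite lt_def Dn0 D0 D1.
have Dsum n : \sum_(i < n) D i `^ s1 <= eps / 2.
  rewrite -lee_fin -sumEFin; apply: le_trans (ltW Usum).
  apply: le_trans (nneseries_lim_ge (m := 0%N) (P := xpredT) n _); last first.
    by move=> *; exact: hterm_ge0.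
  by rewrite big_mkord; apply: lee_sum => i _; exact: Dterm.
have wsum n : \sum_(i < n) w i `^ s1 <= (4 * 36 ^+ d)^-1.
  under eq_bigr do rewrite wE.
  rewrite big_split /= -mulr_sumr.
  have : eps / 2 * \sum_(i < n) 2 ^- i.+1 <= eps / 2.
    by rewrite ler_piMr ?sum_half_le1 // divr_ge0 // ltW.
  by have := Dsum n; rewrite -/eps; lra.
have [a [aD afar]] := Dset_avoids _ _ _ (fun i j => c i ord0 j) _ d0 eta_gt s1_gt0 s1_lt w0 wsum.
have [i _ Uia] := UD a aD.
have [j] := afar i; rewrite ltNge => /negP; apply.
apply: le_trans (Dw i); apply: le_trans (coord_le_edist a (c i) j) _.
rewrite -lee_fin -DE; apply: edist_le_ediam => //.
by apply: cP; exists a.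
Qed.

(** * Upper bound for the dimension *)

(** The cover is reindexed by [nat] through [pickle]; numbers coding no index receive the empty set,
    whose term is 0 for every [s]. *)
Lemma hausdorff_delta_le_esum {R : realType} (d : nat) (s delta : R) (A : set 'rV[R]_d)
    (T : countType) (U : T -> set 'rV[R]_d) : 0 <= delta ->
  A `<=` \bigcup_i U i -> (forall i, (ediam (U i) <= delta%:E)%E) ->
  (hausdorff_delta s delta A <= \esum_(i in [set: T]) hterm s (U i))%E.
Proof.
move=> delta0 AU Ud.
pose U' n := if @pickle_inv T n is Some i then U i else set0.
have -> : (\esum_(i in [set: T]) hterm s (U i) = \sum_(n <oo) hterm s (U' n))%E.
  rewrite nneseries_esumT; last by move=> n; exact: hterm_ge0.
  have -> : (\esum_(n in [set: nat]) hterm s (U' n) =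
      \esum_(n in range (@pickle T)) hterm s (U' n))%E.
    rewrite [RHS]esum_mkcond; apply: eq_esum => n _; case: ifPn => // /negP nr.
    rewrite /U'; case E : (pickle_inv n) => [i|]; last first.
      by rewrite /hterm; case: ifPn => // /asboolP.
    case: nr; rewrite inE; exists i => //.
    by have := @pickle_invK T n; rewrite E.
  rewrite esum_image; last by move=> i j _ _; exact: (pcan_inj (@pickleK T)).
  by apply: eq_esum => i _; rewrite /U' pickleK_inv.
apply: ereal_inf_lbound; exists U' => //; split.
  by move=> x /AU[i _ Uix]; exists (pickle i) => //; rewrite /U' pickleK_inv.
move=> n; rewrite /U'; case: pickle_inv => //.
by rewrite ediam_set0 lee_fin.
Qed.

(** The convergence half of Borel-Cantelli for Hausdorff measure: for every [t0] the levels from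
    [t0] on cover [A], and their s-sums are dominated by the tail of a geometric series. *)
Lemma hausdorff_measure_limsup_eq0 {R : realType} (d : nat) (s : R) (A : set 'rV[R]_d)
    (K : nat -> finType) (B : forall t, K t -> set 'rV[R]_d) (r : nat -> R) (C kappa : R) :
  0 <= s -> 0 <= C -> 0 < kappa < 1 ->
  (forall t, 0 <= r t) -> (forall delta, 0 < delta -> \forall t \near \oo, r t <= delta) ->
  (forall t i, (ediam (B t i) <= (r t)%:E)%E) ->
  (forall t, #|K t|%:R * r t `^ s <= C * kappa ^+ t) ->
  (forall x, A x -> forall t0, exists t (i : K t), (t0 <= t)%N /\ B t i x) ->
  hausdorff_measure s A = 0%E.
Proof.
move=> s0 C0 /andP[kappa0 kappa1] r0 rcvg Bdiam count Alim.
have kn1 : `|kappa| < 1 by rewrite ger0_norm // ltW.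
apply/eqP; rewrite eq_le; apply/andP; split; last first.
  apply: (@le_trans _ _ (hausdorff_delta s 1 A)).
    by apply: le_ereal_inf_tmp => _ [U _ <-]; apply: nneseries_ge0 => *; exact: hterm_ge0.
  by apply: ereal_sup_ubound; exists 1 => //=; exact: ltr01.
apply: ge_ereal_sup => _ [delta /= delta0 <-].
apply/lee_addgt0Pr => e e0; rewrite add0e.
have [t0 [r_le geo_le]] : exists t0, (forall t, (t0 <= t)%N -> r t <= delta) /\
    C * kappa ^+ t0 / (1 - kappa) <= e.
  have [M _ MP] := rcvg _ delta0.
  have /cvgrPdist_le/(_ e e0)[M' _ M'P] := cvg_geometric (C / (1 - kappa)) kn1.
  exists (maxn M M'); split.
    by move=> t; rewrite geq_max => /andP[le _]; exact: MP.
  have := M'P (maxn M M') (leq_maxr _ _); rewrite sub0r normrN mulrAC.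
  exact: le_trans (ler_norm _).
pose T := {t : nat & K (t0 + t)%N}.
pose U (k : T) := B (t0 + tag k)%N (tagged k).
apply: le_trans (_ : \esum_(k in [set: T]) hterm s (U k) <= _)%E.
  apply: hausdorff_delta_le_esum; first exact: ltW.
    move=> x Ax; have [t [i [le Bx]]] := Alim x Ax t0.
    move: i Bx; rewrite -(subnKC le) => i Bx.
    by exists (existT (fun t => K (t0 + t)%N) (t - t0)%N i).
  move=> k; apply: le_trans (Bdiam _ _) _.
  by rewrite lee_fin r_le // leq_addr.
pose J t : set T := range (existT (fun t => K (t0 + t)%N) t).
have -> : [set: T] = \bigcup_(t in [set: nat]) J t.
  by apply/seteqP; split => // -[t i] _; exists t => //; exists i.
rewrite esum_bigcupT; first last.
- by move=> k; exact: hterm_ge0.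
- by move=> t t' _ _ [k [[i _ <-] [i' _ /(congr1 tag)]]] /=.
rewrite -nneseries_esumT; last by move=> t; apply: esum_ge0 => *; exact: hterm_ge0.
have level t : (\esum_(k in J t) hterm s (U k) <= (C * kappa ^+ t0 * kappa ^+ t)%:E)%E.
  rewrite esum_image; last by move=> i j _ _ /eqP; rewrite eq_Tagged => /eqP.
  rewrite esum_fset; first last.
  - by move=> *; exact: hterm_ge0.
  - exact: finite_finset.
  have -> : [set: K (t0 + t)%N] = [set` index_enum (K (t0 + t)%N)].
    by apply/seteqP; split => // i _; exact: mem_index_enum.
  rewrite -fsbig_seq ?index_enum_uniq //=.
  apply: le_trans (_ : \sum_(i : K (t0 + t)%N) (r (t0 + t)%N `^ s)%:E <= _)%E.
    by apply: lee_sum => i _; apply: hterm_le => //; exact: Bdiam.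
  rewrite sumEFin lee_fin sumr_const -mulr_natl -mulrA -exprD.
  exact: count.
have level_ge0 t : (0 <= \esum_(k in J t) hterm s (U k))%E.
  by apply: esum_ge0 => k _; exact: hterm_ge0.
apply: (lime_le (is_cvg_nneseries (fun t _ _ => level_ge0 t))); apply: nearW => n.
apply: le_trans (lee_sum _ (fun t _ => level t)) _.
rewrite sumEFin lee_fin; apply: le_trans geo_le.
by apply: geometric_le_lim => //; rewrite mulr_ge0 ?exprn_ge0 // ltW.
Qed.

Lemma shifted_ordinal (P : nat) (n : int) : (`|n| <= P)%N ->
  exists i : 'I_(P + P).+1, n = (i : nat)%:Z - P%:Z.
Proof.
move=> nP; have lt : (absz (n + P%:Z)%R < (P + P).+1)%N by lia.
by exists (Ordinal lt) => /=; lia.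
Qed.

(** If all such denominators were below [Q], only finitely many points of [NA eta a] would have
    coordinates bounded by 1, and 0 could not be an accumulation point. *)
Lemma Dset_approx {R : realType} (d : nat) (eta : R) (a : 'rV[R]_d) (Q : nat) : 0 <= eta ->
  Dset eta a -> exists (q : nat) (p : 'I_d -> int), [/\ (0 < q)%N, (Q <= q)%N &
    forall j, `|q%:R * a ord0 j - (p j)%:~R| <= q%:R `^ (- eta)].
Proof.
move=> eta0 aD.
pose F := [set y | NA eta a y /\ forall j, `|y ord0 j| <= 1].
pose A := \sum_j `|a ord0 j|.
have AP j : `|a ord0 j| <= A by rewrite /A (bigD1 j) //= lerDl sumr_ge0.
have A0 : 0 <= A by apply: sumr_ge0.
have NAbound (q : int) (p : 'rV[int]_d) : q != 0 -> (forall j,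
    `|((`|q%:~R| `^ eta : R) *: (q%:~R *: a - map_mx (fun z : int => z%:~R) p)) ord0 j| <= 1) ->
    forall j, `|(q%:~R * a ord0 j - (p ord0 j)%:~R : R)| <= (`|q|%N)%:R `^ (- eta).
  move=> q0 h j; have := h j; rewrite !mxE normrM ger0_norm ?powR_ge0 //.
  have qa : 0 < `|q%:~R| `^ eta :> R by rewrite powR_gt0 // normr_gt0 intr_eq0.
  by rewrite mulrC -ler_pdivlMr // div1r natr_absz intr_norm powRN.
apply: contrapT => none.
have small (q : int) (p : 'rV[int]_d) : q != 0 -> (forall j,
    `|(q%:~R * a ord0 j - (p ord0 j)%:~R : R)| <= (`|q|%N)%:R `^ (- eta)) -> (`|q| < Q)%N.
  move=> q0 h; rewrite ltnNge; apply/negP => le; apply: none.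
  (* Multiplying [p] by the sign of [q] makes the denominator positive and preserves the error. *)
  exists `|q|%N, (fun j => Num.sg q * p ord0 j); split => //; first by rewrite absz_gt0.
  move=> j; apply: le_trans (h j); rewrite natr_absz.
  have -> : `|q|%:~R * a ord0 j - (Num.sg q * p ord0 j)%:~R =
      (Num.sg q)%:~R * (q%:~R * a ord0 j - (p ord0 j)%:~R) :> R.
    by rewrite normrEsg !intrM; ring.
  rewrite normrM -intr_norm normr_sg q0 mul1r lexx //.
have finF : finite_set F.
  (* The error is at most 1, so |p_j| is at most |q| |a_j| + 1. *)
  pose P := Num.truncn (Q%:R * A + 1).
  pose Y (k : 'I_(Q + Q).+1 * {ffun 'I_d -> 'I_(P + P).+1}) : 'rV[R]_d :=
    let q : int := (k.1 : nat)%:Z - Q%:Z in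
    (`|q%:~R| `^ eta : R) *: (q%:~R *: a - map_mx (fun z : int => z%:~R)
      (\row_j ((k.2 j : nat)%:Z - P%:Z))).
  apply: (@sub_finite_set _ _ (range Y)); last by apply: finite_image; exact: finite_finset.
  move=> y [[q [p [q0 ->]]] y1].
  have bnd := NAbound q p q0 y1; have qQ := small q p q0 bnd.
  have [i iE] := shifted_ordinal _ _ (ltnW qQ).
  have pex j : exists l : 'I_(P + P).+1, p ord0 j = (l : nat)%:Z - P%:Z.
    apply: shifted_ordinal; rewrite truncn_ge_nat ?addr_ge0 ?mulr_ge0 //.
    rewrite natr_absz intr_norm.
    have q1 : (`|q|%N)%:R `^ (- eta) <= 1 :> R.
      rewrite powRN invf_le1; last by rewrite powR_gt0 // ltr0n absz_gt0.
      have : 1 `^ eta <= (`|q|%N)%:R `^ eta :> R.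
        by rewrite ge0_ler_powR ?nnegrE // ler1n absz_gt0.
      by rewrite powR1.
    have := ler_distD (q%:~R * a ord0 j) 0 (p ord0 j)%:~R.
    rewrite !sub0r !normrN => /le_trans; apply; apply: lerD.
      rewrite normrM ler_pM // -intr_norm -natr_absz ler_nat ltnW //.
    exact: le_trans (bnd j) q1.
  have [l lE] := choice pex.
  exists (i, [ffun j => l j]) => //; rewrite /Y /= -iE; congr (_ *: (_ - map_mx _ _)).
  by apply/rowP => j; rewrite mxE ffunE -lE.
have Acc0 : Acc eta a 0 by rewrite aD.
have clF : closed (F `\ 0).
  apply: (accessible_finite_set_closed.1 _ _ (finite_setD _ finF)).
  apply: hausdorff_accessible; exact: norm_hausdorff.
have := Acc0 (~` (F `\ 0) `&` ball 0 1).
case.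
  apply: filterI; last exact: nbhsx_ballx.
  apply: open_nbhs_nbhs; split; first exact: closed_openC.
  by move=> [_]; apply.
move=> y [y0 yNA [yF yb]]; apply: yF; split; last exact/eqP.
split => // j; case: yb => _ /(_ ord0 j).
by rewrite /ball /= mxE sub0r normrN => /ltW.
Qed.

Lemma powR_neg_lt1 {R : realType} (b x : R) : 1 < b -> x < 0 -> b `^ x < 1.
Proof.
move=> b1 x0; rewrite -[x]opprK powRN invf_lt1 ?powR_gt0 ?(lt_trans ltr01) //.
have nx : 0 < - x by rewrite oppr_gt0.
have : 1 `^ (- x) < b `^ (- x) by rewrite gt0_ltr_powR ?nnegrE // ltW // (lt_trans ltr01).
by rewrite powR1.
Qed.

Lemma geometric_near_le {R : realType} (z e : R) : 0 <= z -> z < 1 -> 0 < e ->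
  \forall n \near \oo, z ^+ n <= e.
Proof.
move=> z0 z1 e0.
have zn : `|z| < 1 by rewrite ger0_norm.
have /cvgrPdist_le/(_ e e0) := cvg_geometric 1 zn.
apply: filterS => n; rewrite sub0r normrN /geometric /= mul1r.
exact: le_trans (ler_norm _).
Qed.

Lemma hausdorff_measure_Dset_eq0 {R : realType} (d : nat) (eta s : R) :
  (0 < d)%N -> 0 <= eta -> d.+1%:R < (1 + eta) * s ->
  hausdorff_measure s (@Dset R d eta) = 0%E.
Proof.
move=> d0 eta0 s_gt.
have dR0 : 0 < d%:R :> R by rewrite ltr0n.
have eta1 : 0 < 1 + eta by rewrite ltr_pwDl.
have s0 : 0 < s by rewrite -(pmulr_rgt0 _ eta1) (lt_trans _ s_gt).
(* The excess (1 + eta) s - (d + 1) equals 2 d [gam]: half of it pays for the growing range of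
   numerators, the other half makes [kappa] less than 1. *)
pose gam := ((1 + eta) * s - d.+1%:R) / (2 * d%:R).
have gam0 : 0 < gam by rewrite divr_gt0 ?mulr_gt0 // subr_gt0.
pose th : R := 2 `^ gam; pose be : R := 2 `^ (- (1 + eta)).
have th0 : 0 < th by rewrite powR_gt0.
have be0 : 0 < be by rewrite powR_gt0.
have be1 : be < 1 by apply: powR_neg_lt1; rewrite ?oppr_lt0 // ltr1n.
have th1 : th^-1 < 1 by rewrite -powRN; apply: powR_neg_lt1; rewrite ?oppr_lt0 // ltr1n.
have th_ge1 : 1 <= th by rewrite ltW // -invf_lt1.
(* Growth rate of the s-sum per level: up to constants there are 2^t denominators, (2 th)^(dt)
   numerator vectors and a factor be^(st) from the radii. *)
pose kappa := 2 ^+ d.+1 * th ^+ d * be `^ s.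
have kappaE : kappa = 2 `^ (- (gam * d%:R)).
  rewrite /kappa -powR_mulrn // -(powR_mulrn _ (ltW th0)) -!powRrM.
  rewrite -!powRD ?pnatr_eq0 ?implybT //; congr (_ `^ _).
  by rewrite /gam; field; rewrite gt_eqF.
have kappa01 : 0 < kappa < 1.
  rewrite kappaE powR_gt0 //=; apply: powR_neg_lt1; first by rewrite ltr1n.
  by rewrite oppr_lt0 mulr_gt0.
(* Level [t] of the cover only uses numerators |p_j| <= O t; as th > 1, the bound
   on |p/q| grows with [t], so the whole space is reached at once. *)
pose O t := Num.truncn (2 ^+ t.+1 * th ^+ t).
have O_le t : (O t)%:R <= 2 ^+ t.+1 * th ^+ t.
  by rewrite truncn_le mulr_ge0 ?exprn_ge0 // ltW.
(* A pair codes the denominator [2 ^ t + k.1], running over one dyadic block, and the numerators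
   shifted by [O t] to make them natural numbers. *)
pose K t : finType := ('I_(2 ^ t) * {ffun 'I_d -> 'I_(O t + O t).+1})%type.
pose center t (k : K t) j : R := ((k.2 j : nat)%:Z - (O t)%:Z)%:~R / (2 ^ t + k.1)%N%:R.
pose B t (k : K t) := [set x : 'rV[R]_d | forall j, `|x ord0 j - center t k j| <= be ^+ t].
pose r t := d%:R * (2 * be ^+ t).
pose C := 5 ^+ d * (2 * d%:R) `^ s.
apply: (@hausdorff_measure_limsup_eq0 R d s _ K B r C kappa) => //.
- exact: ltW.
- by rewrite mulr_ge0 ?exprn_ge0 ?powR_ge0.
- by move=> t; rewrite !mulr_ge0 ?exprn_ge0 // ltW.
- move=> delta delta0.
  have e0 : 0 < delta / (2 * d%:R) by rewrite divr_gt0 // mulr_gt0.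
  apply: filterS (geometric_near_le _ _ (ltW be0) be1 e0) => n.
  by rewrite ler_pdivlMr ?mulr_gt0 // /r; lra.
- move=> t k; apply: ediam_le; first by rewrite !mulr_ge0 ?exprn_ge0 // ltW.
  move=> x y xB yB; apply: edist_le_coord; first by rewrite mulr_ge0 ?exprn_ge0 // ltW.
  move=> j; have := xB j; have := yB j; rewrite !ler_norml => /andP[? ?] /andP[? ?].
  by apply/andP; split; lra.
- move=> t.
  have cardK : #|K t|%:R <= 2 ^+ t * (5 * (2 ^+ t * th ^+ t)) ^+ d :> R.
    rewrite card_prod card_ffun !card_ord natrM !natrX ler_wpM2l ?exprn_ge0 //.
    rewrite lerXn2r ?nnegrE ?mulr_ge0 ?exprn_ge0 ?(ltW th0) //.
    rewrite -natr1 natrD.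
    have : 1 <= 2 ^+ t * th ^+ t by rewrite mulr_ege1 // exprn_ege1 // ler1n.
    by have := O_le t; rewrite exprS; lra.
  apply: le_trans (ler_wpM2r (powR_ge0 _ _) cardK) _.
  have -> : r t = 2 * d%:R * be ^+ t by rewrite /r; ring.
  rewrite powRM ?mulr_ge0 ?exprn_ge0 ?(ltW be0) //.
  have -> : (be ^+ t) `^ s = (be `^ s) ^+ t.
    by rewrite -!powR_mulrn ?powR_ge0 ?(ltW be0) // powRAC.
  have -> : kappa = 2 * (2 * th) ^+ d * be `^ s by rewrite /kappa exprS exprMn; ring.
  rewrite -exprMn [(5 * _) ^+ d]exprMn exprAC.
  rewrite [(_ * be `^ s) ^+ t]exprMn [(2 * (_ ^+ d)) ^+ t]exprMn /C.
  by rewrite le_eqVlt; apply/orP; left; apply/eqP; ring.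
move=> a aD t0.
pose A : R := \sum_j `|a ord0 j|.
have AP j : `|a ord0 j| <= A by rewrite /A (bigD1 j) //= lerDl sumr_ge0.
have A0 : 0 <= A by apply: sumr_ge0.
have A1 : 0 < (A + 1)^-1 by rewrite invr_gt0 ltr_wpDl.
have thV0 : 0 <= th^-1 by rewrite invr_ge0 ltW.
(* From level [M] on, th^t is at least A + 1, so the numerators approximating [a] are in range. A
   denominator of at least [2 ^ maxn t0 M] puts the level past both [t0] and [M]. *)
have [M _ MP] := geometric_near_le _ _ thV0 th1 A1.
have [q [p [q0 Qq qp]]] := Dset_approx _ _ _ (2 ^ maxn t0 M) eta0 aD.
have /andP[tq qt] := trunc_log_bounds (ltnSn 1) q0.
set t := trunc_log 2 q in tq qt.
have tge : (maxn t0 M <= t)%N by rewrite -ltnS -(ltn_exp2l _ _ (ltnSn 1)) (leq_ltn_trans Qq).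
move: tge; rewrite geq_max => /andP[t0t Mt].
have thA : A + 1 <= th ^+ t.
  by have := MP t Mt; rewrite /= exprVn lef_pV2 ?posrE ?exprn_gt0 // ltr_wpDl.
have qR0 : 0 < q%:R :> R by rewrite ltr0n.
have q1 : q%:R `^ (- eta) <= 1 :> R.
  rewrite powRN invf_le1 ?powR_gt0 //.
  have : 1 `^ eta <= q%:R `^ eta :> R by rewrite ge0_ler_powR ?nnegrE // ler1n.
  by rewrite powR1.
have pex j : exists l : 'I_(O t + O t).+1, p j = (l : nat)%:Z - (O t)%:Z.
  apply: shifted_ordinal.
  rewrite truncn_ge_nat ?mulr_ge0 ?exprn_ge0 ?(ltW th0) // natr_absz intr_norm.
  apply: le_trans (_ : q%:R * (A + 1) <= _).
    have := ler_distD (q%:R * a ord0 j) 0 (p j)%:~R.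
    rewrite !sub0r !normrN => /le_trans; apply; rewrite mulrDr; apply: lerD.
      by rewrite normrM ger0_norm // ler_wpM2l.
    by rewrite mulr1; apply: le_trans (qp j) _; apply: le_trans q1 _; rewrite ler1n.
  apply: ler_pM => //; first by rewrite addr_ge0.
  by rewrite -natrX ler_nat ltnW.
have [l lE] := choice pex.
have iq : (q - 2 ^ t < 2 ^ t)%N by rewrite ltn_subLR // addnn -mul2n -expnS.
exists t, (Ordinal iq, [ffun j => l j]); split => // j.
rewrite /center /= ffunE -lE subnKC //.
have -> : a ord0 j - (p j)%:~R / q%:R = (q%:R * a ord0 j - (p j)%:~R) / q%:R.
  by field; rewrite gt_eqF.
rewrite normrM normfV (ger0_norm (ltW qR0)).
apply: le_trans (_ : q%:R `^ (- eta) / q%:R <= _).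
  by rewrite ler_wpM2r ?invr_ge0.
have -> : q%:R `^ (- eta) / q%:R = (q%:R `^ (1 + eta))^-1 :> R.
  by rewrite powRD ?(gt_eqF qR0) ?implybT // powRr1 ?(ltW qR0) // invfM powRN mulrC.
have -> : be ^+ t = ((2 ^+ t) `^ (1 + eta))^-1.
  by rewrite -!powR_mulrn ?powR_ge0 // -powRN -!powRrM; congr (_ `^ _); ring.
rewrite lef_pV2 ?posrE ?powR_gt0 ?exprn_gt0 //.
rewrite ge0_ler_powR ?nnegrE ?(ltW eta1) ?exprn_ge0 //.
by rewrite -natrX ler_nat.
Qed.

Theorem theorem3 (R : realType) (d : nat) (eta : R) :
  (0 < d)%N -> (d%:R)^-1 < eta ->
  hausdorff_dim (@Dset R d eta) = ((d.+1)%:R / (1 + eta))%:E.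
Proof.
move=> d0 eta_gt.
have eta0 : 0 < eta by apply: le_lt_trans eta_gt; rewrite invr_ge0.
have eta1 : 0 < 1 + eta by rewrite ltr_wpDl.
apply/eqP; rewrite eq_le; apply/andP; split.
  (* The critical exponent itself is approached from above, by exponents of measure zero. *)
  apply/lee_addgt0Pr => e e0; rewrite -EFinD.
  apply: ereal_inf_lbound; exists (d.+1%:R / (1 + eta) + e) => //; split.
    by rewrite addr_ge0 ?divr_ge0 // ltW.
  apply: hausdorff_measure_Dset_eq0 => //; first exact: ltW.
  by rewrite mulrC -ltr_pdivrMr // ltrDl.
apply: le_ereal_inf_tmp => _ [s [s0 sH] <-]; rewrite lee_fin leNgt; apply/negP => lt.
apply: (hausdorff_measure_Dset_neq0 _ _ _ d0 eta_gt s0 _ sH).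
by rewrite mulrC -ltr_pdivlMr.
Qed.
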